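(* Let $P=[a_1,a_2,a_3,a_4]$ be a (non-degenerate) parallelogram in the plane $\mathbb{C}$ with vertices $a_1,a_2,a_3,a_4$, and for each $i\in\{1,2,3,4\}$ let $\alpha_i$ be half of the (interior) angle of $P$ at the vertex $a_i$. For $i,j,k,l\in\{1,2,3,4\}$ all different, let $b_{ijkl}$ be the fixed point of the composition of rotations $r_{a_i,\alpha_i}r_{a_j,\alpha_j}r_{a_k,\alpha_k}r_{a_l,\alpha_l}$. Then each of the following is a square: \begin{align*} P^e&:=[b_{1234},b_{1243},b_{2143},b_{2134}],\\ P^{(13)(24)}&:=[b_{3412},b_{3421},b_{4321},b_{4312}],\\ P^{(24)}&:=[b_{1432},b_{1423},b_{4123},b_{4132}],\\ P^{(13)}&:=[b_{3214},b_{3241},b_{2341},b_{2314}]. \end{align*} Moreover, $P^e$ can be transformed into $P^{(13)(24)}$ by a translation, and $P^{(24)}$ can be transformed into $P^{(13)}$ by a translation. Finally, each of the following is a parallelogram: \begin{align*} P^{(23)}&:=[b_{1324},b_{1342},b_{3142},b_{3124}],\\ P^{(1342)}&:=[b_{2413},b_{2431},b_{4231},b_{4213}]. \end{align*}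
   Context: The plane $\mathbb{R}^2$ is identified with $\mathbb{C}$, and $i$ in exponents $e^{i\alpha}$ denotes the imaginary unit. For $a\in\mathbb{C}$ and $\alpha\in\mathbb{R}$, $r_{a,\alpha}:\mathbb{C}\to\mathbb{C}$, $z\mapsto e^{i\alpha}(z-a)+a$, is the rotation about $a$ by angle $\alpha$. Juxtaposition of maps denotes composition, with the rightmost map applied first. $[p_1,p_2,p_3,p_4]$ denotes the quadrilateral with vertices $p_1,p_2,p_3,p_4$ and edges $p_1p_2,\ p_2p_3,\ p_3p_4,\ p_4p_1$ (so the symbols may be circularly permuted or reversed in order). Since the interior angles of $P$ sum to $2\pi$, one has $\alpha_1+\alpha_2+\alpha_3+\alpha_4=\pi$; hence for $\{i,j,k,l\}=\{1,2,3,4\}$ the composition $r_{a_i,\alpha_i}r_{a_j,\alpha_j}r_{a_k,\alpha_k}r_{a_l,\alpha_l}$ is a rotation by angle $\pi$ and has a unique fixed point, so $b_{ijkl}$ is well defined. In the conclusion, ''$[p_1,p_2,p_3,p_4]$ is a parallelogram'' means $p_1-p_2=p_4-p_3$ (equality of the vectors of opposite edges; degenerate, i.e. collinear, parallelograms are allowed). A square is such a parallelogram whose adjacent edges have the same nonzero length and are perpendicular. ''Transformed by a translation'' is meant for the quadrilaterals as figures: some translation maps the vertex set of one onto the vertex set of the other and edges to edges, without necessarily respecting the order in which the vertices are listed. *)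

(* Defs.v *)
(* The plane is the type C of complex numbers. *)
From Stdlib Require Import Reals ClassicalEpsilon.
From Coquelicot Require Import Coquelicot.

Open Scope C_scope.

Definition dot (u v : C) : R := Re (u * Cconj v).
Definition cross (u v : C) : R := Im (Cconj u * v).

Definition angle (u v : C) : R := acos (dot u v / (Cmod u * Cmod v)).

(* e^{i t} *)
Definition expi (t : R) : C := (cos t, sin t).

Definition rot (a : C) (t : R) (z : C) : C := expi t * (z - a) + a.

Record quad := Quad { q1 : C; q2 : C; q3 : C; q4 : C }.

(* Collinear ("flat") parallelograms are allowed. *)
Definition parallelogram (P : quad) : Prop :=
  q1 P - q2 P = q4 P - q3 P.

Definition nondegenerate_parallelogram (P : quad) : Prop :=
  parallelogram P /\ cross (q2 P - q1 P) (q4 P - q1 P) <> 0%R.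

(* Opposite edges of a parallelogram are equal as vectors, so one pair of
   adjacent edges suffices. *)
Definition square (P : quad) : Prop :=
  parallelogram P /\
  Cmod (q1 P - q2 P) = Cmod (q2 P - q3 P) /\
  Cmod (q1 P - q2 P) <> 0%R /\
  dot (q1 P - q2 P) (q2 P - q3 P) = 0%R.

Definition is_vertex (P : quad) (x : C) : Prop :=
  x = q1 P \/ x = q2 P \/ x = q3 P \/ x = q4 P.

(* Edges are unordered pairs of vertices. *)
Definition is_edge (P : quad) (x y : C) : Prop :=
  let joins p q := (x = p /\ y = q) \/ (x = q /\ y = p) in
  joins (q1 P) (q2 P) \/ joins (q2 P) (q3 P) \/
  joins (q3 P) (q4 P) \/ joins (q4 P) (q1 P).

(* Equality of figures up to translation: the listing of the vertices of P
   need not be sent to the listing of the vertices of Q. *)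
Definition translation_equivalent (P Q : quad) : Prop :=
  exists v : C,
    (forall x, is_vertex P x <-> is_vertex Q (x + v)) /\
    (forall x y, is_edge P x y <-> is_edge Q (x + v) (y + v)).

Inductive index := I1 | I2 | I3 | I4.

Definition next (i : index) : index :=
  match i with I1 => I2 | I2 => I3 | I3 => I4 | I4 => I1 end.

Definition prev (i : index) : index :=
  match i with I1 => I4 | I2 => I1 | I3 => I2 | I4 => I3 end.

(* The unoriented angle in [0, PI] between the two edges at a vertex: this is
   the interior angle when the quadrilateral is convex, whichever way its
   boundary is traversed. *)
Definition interior_angle (a : index -> C) (i : index) : R :=
  angle (a (next i) - a i) (a (prev i) - a i).

Definition half_angle (a : index -> C) (i : index) : R :=
  (interior_angle a i / 2)%R.

Definition rot4 (a : index -> C) (i j k l : index) (z : C) : C :=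
  let r m := rot (a m) (half_angle a m) in
  r i (r j (r k (r l z))).

(* The fixed point of f; meaningful only if f has exactly one. *)
Definition fixed_point (f : C -> C) : C :=
  epsilon (inhabits (RtoC 0)) (fun z => f z = z).

Lemma fixed_pointP (f : C -> C) :
  (exists! z, f z = z) -> forall z, f z = z <-> z = fixed_point f.
Proof.
intros [w [Hw Huniq]].
assert (Hf : f (fixed_point f) = fixed_point f).
{ apply (epsilon_spec (inhabits (RtoC 0)) (fun z => f z = z)). now exists w. }
intros z; split; intros Hz.
- now rewrite <- (Huniq z Hz), <- (Huniq _ Hf).
- now rewrite Hz.
Qed.

Definition b_point (a : index -> C) (i j k l : index) : C :=
  fixed_point (rot4 a i j k l).

(* Main.v *)
Require Import Defs.
From Stdlib Require Import Reals Lra.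
From Coquelicot Require Import Coquelicot.

Local Open Scope C_scope.

(** Write [u m] for the unit complex number of argument [half_angle a m].  The
    composition r_i r_j r_k r_l is an affine map whose linear coefficient is
    u_i u_j u_k u_l.  When this product is -1, the map is a half-turn and its
    fixed point is half of its constant term
      (1-u_i) a_i + u_i (1-u_j) a_j + u_i u_j (1-u_k) a_k
        + u_i u_j u_k (1-u_l) a_l         ([b_point_value]).

    Exchanging two adjacent indices changes only two terms of this sum:
      2 (b_ijkl - b_ijlk) = u_i u_j (1-u_k) (1-u_l) (a_k - a_l),
      2 (b_ijkl - b_jikl) = (1-u_i) (1-u_j) (a_i - a_j).
    The first right-hand side is symmetric in i and j, so the points obtained
    by exchanging i with j and k with l always form a parallelogram
    ([swap_quad_parallelogram]).  All six quadrilaterals of the theorem have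
    this form.

    In a parallelogram opposite angles are equal and adjacent ones are
    supplementary, so u_1 = u_3, u_2 = u_4 and u_1 u_2 = i
    ([expi_half_angles]).  If i, j are adjacent vertices and k, l are the
    vertices opposite to them, then a_k - a_l = -(a_i - a_j), and the two
    differences above become -i w and w, with
    w = (1-u_i) (1-u_j) (a_i - a_j) nonzero: the parallelogram is a square
    ([swap_quad_square]).  Replacing i, j, k, l by k, l, i, j changes the sign
    of w, hence of every edge vector; the new square is therefore a translate
    of the old one whose listing starts from the opposite vertex
    ([swap_quad_translation]). *)

(** * Parallelograms and squares *)

(** Multiplication by [Ci] is a quarter-turn. *)
Lemma square_of_quarter_turn (P : quad) :
  parallelogram P -> q1 P <> q2 P ->
  q2 P - q3 P = Ci * (q1 P - q2 P) -> square P.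
Proof.
intros HP Hne Hturn; split; [exact HP|].
rewrite Hturn; split; [|split].
- rewrite Cmod_mult.
  assert (HCi : Cmod Ci = 1%R).
  { unfold Cmod, Ci; simpl.
    replace (0 * (0 * 1) + 1 * (1 * 1))%R with 1%R by ring.
    exact sqrt_1. }
  rewrite HCi; ring.
- intros H0; apply Hne.
  apply Cmod_eq_0 in H0.
  replace (q1 P) with (q1 P - q2 P + q2 P) by ring.
  rewrite H0; ring.
- destruct (q1 P - q2 P) as [x y].
  unfold dot; simpl; ring.
Qed.

(** Such quadrilaterals are images of each other under a point reflection, and
    a parallelogram is its own image under the reflection in its centre. *)
Lemma translation_equivalent_of_opposite_edges (P Q : quad) :
  parallelogram P -> parallelogram Q ->
  q1 Q - q2 Q = - (q1 P - q2 P) -> q2 Q - q3 Q = - (q2 P - q3 P) ->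
  translation_equivalent P Q.
Proof.
destruct P as [p1 p2 p3 p4], Q as [r1 r2 r3 r4].
unfold parallelogram; simpl; intros HP HQ H12 H23.
(* The first vertex of Q is the translate of the third vertex of P. *)
exists (r1 - p3).
set (v := r1 - p3).
assert (E1 : r1 = p3 + v) by (unfold v; ring).
assert (E2 : r2 = p4 + v).
{ replace r2 with (r1 - (r1 - r2)) by ring; rewrite H12, HP, E1; ring. }
assert (E3 : r3 = p1 + v).
{ replace r3 with (r2 - (r2 - r3)) by ring; rewrite H23, E2.
  replace p1 with (p1 - p2 + p2) by ring; rewrite HP; ring. }
assert (E4 : r4 = p2 + v).
{ replace r4 with (r4 - r3 + r3) by ring; rewrite <- HQ, H12, E3; ring. }
clearbody v.
assert (Hinj : forall x y, x + v = y + v <-> x = y).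
{ intros x y; split; [intros H | now intros ->].
  replace x with (x + v - v) by ring; rewrite H; ring. }
split.
- intros x; unfold is_vertex; simpl.
  rewrite E1, E2, E3, E4, !Hinj; tauto.
- intros x y; unfold is_edge; simpl.
  rewrite E1, E2, E3, E4, !Hinj; tauto.
Qed.

(** * Fixed points of compositions of four rotations *)

Definition turn (a : index -> C) (m : index) : C := expi (half_angle a m).

Definition turn_product (a : index -> C) (i j k l : index) : C :=
  turn a i * turn a j * turn a k * turn a l.

Lemma b_point_value (a : index -> C) (i j k l : index) :
  turn_product a i j k l = - (1) ->
  b_point a i j k l =
    ((1 - turn a i) * a i + turn a i * (1 - turn a j) * a j
     + turn a i * turn a j * (1 - turn a k) * a k
     + turn a i * turn a j * turn a k * (1 - turn a l) * a l) / 2.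
Proof.
set (s := _ / 2); intros Hprod.
assert (H2 : (2 : C) <> 0).
{ intros H; apply (f_equal fst) in H; simpl in H; lra. }
assert (Haff : forall z, rot4 a i j k l z = 2 * s - z).
{ intros z.
  replace (2 * s - z) with (2 * s + - (1) * z) by ring.
  rewrite <- Hprod.
  unfold s, rot4, rot, turn_product, turn; field; exact H2. }
symmetry; apply fixed_pointP.
- exists s; split.
  + rewrite Haff; ring.
  + intros z; rewrite Haff; intros Hz.
    replace s with ((2 * s - z + z) / 2) by (field; exact H2).
    rewrite Hz; field; exact H2.
- rewrite Haff; ring.
Qed.

(** The common shape of the six quadrilaterals: exchanging the last two and the
    first two indices in alternation. *)
Definition swap_quad (a : index -> C) (i j k l : index) : quad :=
  Quad (b_point a i j k l) (b_point a i j l k)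
       (b_point a j i l k) (b_point a j i k l).

Lemma b_point_swap_last (a : index -> C) (i j k l : index) :
  turn_product a i j k l = - (1) ->
  b_point a i j k l - b_point a i j l k =
    turn a i * turn a j * ((1 - turn a k) * (1 - turn a l)) * (a k - a l) / 2.
Proof.
intros Hprod.
rewrite !b_point_value;
  [ | unfold turn_product in *; rewrite <- Hprod; ring | exact Hprod].
unfold Cdiv; ring.
Qed.

Lemma b_point_swap_first (a : index -> C) (i j k l : index) :
  turn_product a i j k l = - (1) ->
  b_point a i j k l - b_point a j i k l =
    (1 - turn a i) * (1 - turn a j) * (a i - a j) / 2.
Proof.
intros Hprod.
rewrite !b_point_value;
  [ | unfold turn_product in *; rewrite <- Hprod; ring | exact Hprod].
unfold Cdiv; ring.
Qed.

(** Exchanging the last two indices gives a difference symmetric in the first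
    two. *)
Lemma swap_quad_parallelogram (a : index -> C) (i j k l : index) :
  turn_product a i j k l = - (1) -> parallelogram (swap_quad a i j k l).
Proof.
intros Hprod; unfold parallelogram; simpl.
rewrite !b_point_swap_last;
  [ | unfold turn_product in *; rewrite <- Hprod; ring | exact Hprod].
unfold Cdiv; ring.
Qed.

(** * Opposite pairs of sides of a parallelogram *)

(** The side from i to j and the opposite side, with k opposite to i and l
    opposite to j. *)
Record opposite_sides (a : index -> C) (i j k l : index) : Prop := {
  opposite_vectors : a k - a l = - (a i - a j);
  opposite_turn_ik : turn a k = turn a i;
  opposite_turn_jl : turn a l = turn a j;
  adjacent_turns : turn a i * turn a j = Ci;
  turn_i_neq_1 : turn a i <> 1;
  turn_j_neq_1 : turn a j <> 1;
  side_neq : a i <> a j }.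

Lemma Ci_sqr : Ci * Ci = - (1).
Proof. apply injective_projections; simpl; ring. Qed.

Lemma opposite_sides_sym (a : index -> C) (i j k l : index) :
  opposite_sides a i j k l -> opposite_sides a k l i j.
Proof.
intros [Hv Hki Hlj Hij Hi Hj Hne]; split; try congruence.
- rewrite Hv; ring.
- intros Hkl; apply Hne.
  replace (a i) with (a i - a j + a j) by ring.
  replace (a i - a j) with (- (a k - a l)) by (rewrite Hv; ring).
  rewrite Hkl; ring.
Qed.

Lemma opposite_sides_product (a : index -> C) (i j k l : index) :
  opposite_sides a i j k l -> turn_product a i j k l = - (1).
Proof.
intros [_ Hki Hlj Hij _ _ _]; unfold turn_product.
rewrite Hki, Hlj, Hij, <- Ci_sqr, <- Hij; ring.
Qed.

Definition half_edge (a : index -> C) (i j : index) : C :=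
  (1 - turn a i) * (1 - turn a j) * (a i - a j) / 2.

Lemma swap_quad_edge_23 (a : index -> C) (i j k l : index) :
  opposite_sides a i j k l ->
  q2 (swap_quad a i j k l) - q3 (swap_quad a i j k l) = half_edge a i j.
Proof.
intros Hopp; simpl; rewrite b_point_swap_first; [reflexivity|].
rewrite <- (opposite_sides_product _ _ _ _ _ Hopp).
unfold turn_product; ring.
Qed.

Lemma swap_quad_edge_12 (a : index -> C) (i j k l : index) :
  opposite_sides a i j k l ->
  q1 (swap_quad a i j k l) - q2 (swap_quad a i j k l) = - (Ci * half_edge a i j).
Proof.
intros Hopp; simpl.
rewrite b_point_swap_last by exact (opposite_sides_product _ _ _ _ _ Hopp).
destruct Hopp as [Hv Hki Hlj Hij _ _ _].
rewrite Hij, Hki, Hlj, Hv; unfold half_edge, Cdiv; ring.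
Qed.

Lemma half_edge_neq_0 (a : index -> C) (i j k l : index) :
  opposite_sides a i j k l -> half_edge a i j <> 0.
Proof.
intros [_ _ _ _ Hi Hj Hne]; unfold half_edge.
intros H.
assert (Hnum : (1 - turn a i) * (1 - turn a j) * (a i - a j) <> 0).
{ repeat apply Cmult_neq_0; apply Cminus_eq_contra; congruence. }
apply Hnum.
assert (H2 : (2 : C) <> 0).
{ intros H2; apply (f_equal fst) in H2; simpl in H2; lra. }
match goal with |- ?x = _ => replace x with (x / 2 * 2) by (field; exact H2) end.
rewrite H; ring.
Qed.

Lemma swap_quad_square (a : index -> C) (i j k l : index) :
  opposite_sides a i j k l -> square (swap_quad a i j k l).
Proof.
intros Hopp.
assert (Hturn : q2 (swap_quad a i j k l) - q3 (swap_quad a i j k l)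
  = Ci * (q1 (swap_quad a i j k l) - q2 (swap_quad a i j k l))).
{ rewrite (swap_quad_edge_12 _ _ _ _ _ Hopp), (swap_quad_edge_23 _ _ _ _ _ Hopp).
  transitivity (- (Ci * Ci) * half_edge a i j); [rewrite Ci_sqr|]; ring. }
apply square_of_quarter_turn; [| |exact Hturn].
- apply swap_quad_parallelogram, opposite_sides_product, Hopp.
- intros H12; apply (half_edge_neq_0 _ _ _ _ _ Hopp).
  rewrite <- (swap_quad_edge_23 _ _ _ _ _ Hopp), Hturn, H12; ring.
Qed.

(** Passing to the opposite side reverses [a i - a j] and keeps the turns, so it
    reverses all the edge vectors. *)
Lemma swap_quad_translation (a : index -> C) (i j k l : index) :
  opposite_sides a i j k l ->
  translation_equivalent (swap_quad a i j k l) (swap_quad a k l i j).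
Proof.
intros Hopp.
assert (Hopp' := opposite_sides_sym _ _ _ _ _ Hopp).
assert (Hneg : half_edge a k l = - half_edge a i j).
{ destruct Hopp as [Hv Hki Hlj _ _ _ _]; unfold half_edge, Cdiv.
  rewrite Hv, Hki, Hlj; ring. }
apply translation_equivalent_of_opposite_edges.
- apply swap_quad_parallelogram, opposite_sides_product, Hopp.
- apply swap_quad_parallelogram, opposite_sides_product, Hopp'.
- rewrite (swap_quad_edge_12 _ _ _ _ _ Hopp), (swap_quad_edge_12 _ _ _ _ _ Hopp').
  rewrite Hneg; ring.
- rewrite (swap_quad_edge_23 _ _ _ _ _ Hopp), (swap_quad_edge_23 _ _ _ _ _ Hopp').
  exact Hneg.
Qed.

(** * Angles of a parallelogram *)

Lemma dot_sym (u v : C) : dot u v = dot v u.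
Proof. destruct u, v; unfold dot; simpl; ring. Qed.

Lemma angle_sym (u v : C) : angle u v = angle v u.
Proof. unfold angle; rewrite dot_sym, (Rmult_comm (Cmod u)); reflexivity. Qed.

Lemma angle_opp_l (u v : C) : angle (- u) v = (PI - angle u v)%R.
Proof.
unfold angle; rewrite <- acos_opp, Cmod_opp.
f_equal; unfold Rdiv.
replace (dot (- u) v) with (- dot u v)%R; [ring|].
destruct u, v; unfold dot; simpl; ring.
Qed.

Lemma Cmod_sqr (u : C) : (Cmod u * Cmod u = dot u u)%R.
Proof.
unfold Cmod; rewrite sqrt_sqrt.
- destruct u; unfold dot; simpl; ring.
- apply Rplus_le_le_0_compat; apply pow2_ge_0.
Qed.

(** Lagrange's identity: dot^2 + cross^2 = |u|^2 |v|^2, so the cosine is strictly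
    between -1 and 1. *)
Lemma angle_bounds (u v : C) : cross u v <> 0%R -> (0 < angle u v < PI)%R.
Proof.
intros Hcross; apply acos_bound_lt.
set (m := (Cmod u * Cmod v)%R).
assert (Hm : (m * m = dot u v * dot u v + cross u v * cross u v)%R).
{ transitivity ((Cmod u * Cmod u) * (Cmod v * Cmod v))%R; [unfold m; ring|].
  rewrite !Cmod_sqr; destruct u, v; unfold dot, cross; simpl; ring. }
assert (Hc : (0 < cross u v * cross u v)%R) by now apply Rsqr_pos_lt.
assert (Hm0 : (0 <= m)%R) by (apply Rmult_le_pos; apply Cmod_ge_0).
assert (Hlt : (Rabs (dot u v) < Rabs m)%R) by (apply Rsqr_lt_abs_0; unfold Rsqr; lra).
rewrite (Rabs_pos_eq m Hm0) in Hlt.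
apply Rabs_def2 in Hlt.
assert (Hmpos : (0 < m)%R) by lra.
split.
- apply Rmult_lt_reg_r with m; [exact Hmpos|]; field_simplify; lra.
- apply Rmult_lt_reg_r with m; [exact Hmpos|]; field_simplify; lra.
Qed.

Lemma expi_neq_1 (t : R) : (0 < t <= PI)%R -> expi t <> 1.
Proof.
intros Ht H; apply (f_equal fst) in H; simpl in H.
assert (cos t < cos 0)%R by (apply cos_decreasing_1; lra).
rewrite cos_0 in *; lra.
Qed.

Lemma expi_add (s t : R) : expi s * expi t = expi (s + t).
Proof.
unfold expi; apply injective_projections; simpl.
- rewrite cos_plus; ring.
- rewrite sin_plus; ring.
Qed.

Lemma expi_right_angle : expi (PI / 2) = Ci.
Proof. unfold expi, Ci; rewrite cos_PI2, sin_PI2; reflexivity. Qed.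

(** With u, v the edge vectors at the first vertex, the pairs of edges at the
    successive vertices are (u, v), (v, -u), (-u, -v), (-v, u). *)
Lemma parallelogram_angles (a : index -> C) :
  parallelogram (Quad (a I1) (a I2) (a I3) (a I4)) ->
  let t := interior_angle a I1 in
  interior_angle a I2 = (PI - t)%R /\
  interior_angle a I3 = t /\
  interior_angle a I4 = (PI - t)%R.
Proof.
unfold parallelogram, interior_angle; simpl; intros HP.
set (u := a I2 - a I1); set (v := a I4 - a I1).
assert (H34 : a I4 - a I3 = - u) by (rewrite <- HP; unfold u; ring).
assert (H23 : a I3 - a I2 = v).
{ replace (a I3 - a I2) with (a I4 - a I2 - (a I4 - a I3)) by ring.
  rewrite H34; unfold u, v; ring. }
replace (a I1 - a I2) with (- u) by (unfold u; ring).
replace (a I2 - a I3) with (- v) by (rewrite <- H23; ring).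
replace (a I1 - a I4) with (- v) by (unfold v; ring).
replace (a I3 - a I4) with u
  by (replace u with (- - u) by ring; rewrite <- H34; ring).
rewrite H23, H34, (angle_sym v), !angle_opp_l, (angle_sym u (- v)).
rewrite angle_opp_l, (angle_sym v); repeat split; ring.
Qed.

Lemma expi_half_angles (a : index -> C) :
  nondegenerate_parallelogram (Quad (a I1) (a I2) (a I3) (a I4)) ->
  turn a I3 = turn a I1 /\ turn a I4 = turn a I2 /\
  turn a I1 * turn a I2 = Ci /\ turn a I1 <> 1 /\ turn a I2 <> 1.
Proof.
intros [HP Hcross].
destruct (parallelogram_angles a HP) as (H2 & H3 & H4).
assert (Hbnd : (0 < interior_angle a I1 < PI)%R) by now apply angle_bounds.
unfold turn, half_angle; rewrite H2, H3, H4; repeat split.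
- rewrite expi_add, <- expi_right_angle; f_equal; field.
- apply expi_neq_1; lra.
- apply expi_neq_1; lra.
Qed.

Lemma sides_neq (a : index -> C) :
  nondegenerate_parallelogram (Quad (a I1) (a I2) (a I3) (a I4)) ->
  a I1 <> a I2 /\ a I1 <> a I4.
Proof.
intros [_ Hcross]; simpl in Hcross.
split; intros H; apply Hcross; rewrite <- H;
  unfold cross; simpl; ring.
Qed.

Lemma parallelogram_opposite_sides (a : index -> C) :
  nondegenerate_parallelogram (Quad (a I1) (a I2) (a I3) (a I4)) ->
  opposite_sides a I1 I2 I3 I4 /\ opposite_sides a I1 I4 I3 I2.
Proof.
intros Hnd.
destruct (expi_half_angles a Hnd) as (H31 & H42 & H12 & Hu1 & Hu2).
destruct (sides_neq a Hnd) as [Hne12 Hne14].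
destruct Hnd as [HP _]; unfold parallelogram in HP; simpl in HP.
split; split; try congruence.
- rewrite HP; ring.
- replace (a I3 - a I2) with (a I4 - a I2 - (a I4 - a I3)) by ring.
  rewrite <- HP; ring.
Qed.

Theorem theorem2 (a : index -> C) :
  nondegenerate_parallelogram (Quad (a I1) (a I2) (a I3) (a I4)) ->
  let b := b_point a in
  let P_e :=
    Quad (b I1 I2 I3 I4) (b I1 I2 I4 I3) (b I2 I1 I4 I3) (b I2 I1 I3 I4) in
  let P_13_24 :=
    Quad (b I3 I4 I1 I2) (b I3 I4 I2 I1) (b I4 I3 I2 I1) (b I4 I3 I1 I2) in
  let P_24 :=
    Quad (b I1 I4 I3 I2) (b I1 I4 I2 I3) (b I4 I1 I2 I3) (b I4 I1 I3 I2) in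
  let P_13 :=
    Quad (b I3 I2 I1 I4) (b I3 I2 I4 I1) (b I2 I3 I4 I1) (b I2 I3 I1 I4) in
  let P_23 :=
    Quad (b I1 I3 I2 I4) (b I1 I3 I4 I2) (b I3 I1 I4 I2) (b I3 I1 I2 I4) in
  let P_1342 :=
    Quad (b I2 I4 I1 I3) (b I2 I4 I3 I1) (b I4 I2 I3 I1) (b I4 I2 I1 I3) in
  (square P_e /\ square P_13_24 /\ square P_24 /\ square P_13) /\
  (translation_equivalent P_e P_13_24 /\ translation_equivalent P_24 P_13) /\
  (parallelogram P_23 /\ parallelogram P_1342).
Proof.
intros Hnd b P_e P_13_24 P_24 P_13 P_23 P_1342.
destruct (parallelogram_opposite_sides a Hnd) as [H1234 H1432].
assert (H3412 := opposite_sides_sym _ _ _ _ _ H1234).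
assert (H3214 := opposite_sides_sym _ _ _ _ _ H1432).
assert (Hprod := opposite_sides_product _ _ _ _ _ H1234).
split; [|split].
- split; [|split; [|split]]; now apply swap_quad_square.
- split; now apply swap_quad_translation.
- split; apply swap_quad_parallelogram; rewrite <- Hprod;
    unfold turn_product; ring.
Qed.
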